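(* There exists an absolute constant $c>0$ such that for any positive integers $n,b,k$ with $b\ge 2$ and $b^k\le 2^{cn}$, there is a generator $\mathrm{FastPRG}:\{0,1\}^{s}\to\{0,1\}^{b^k\cdot n}$ with seed length $s=O(bkn)$ with the following properties: (i) for every finite state machine $Q$ over the alphabet $\{0,1\}^n$ with at most $2^{cn}$ states reading $b^k$ symbols, the matrices of transition probabilities satisfy $\|Q(\mathrm{FastPRG}(\mathbf r))-Q((U_n)^{b^k})\|=O(2^{-cn})$, where $\mathbf r$ is a uniformly random seed; in particular, for every start state and every set of accepting states, the probabilities of ending in an accepting state under the two input distributions differ by $O(2^{-cn})$; (ii) for any seed $r$ and any $i\in\{0,\dots,b^k-1\}$, the $i$-th block of $n$ bits of $\mathrm{FastPRG}(r)$ can be computed in time $O(k)$ on a Word RAM with word size $\Omega(n)$.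
   Context: A finite state machine over alphabet $\{0,1\}^n$ reads a string of symbols from $\{0,1\}^n$ one at a time. For a distribution $D$ on strings of $b^k$ symbols, $Q(D)$ denotes the matrix whose $(i,j)$ entry is the probability that $Q$ started in state $i$ ends in state $j$ after reading an input drawn from $D$; $(U_n)^{b^k}$ is the uniform distribution on such strings; $\|M\|=\max_i\sum_j|M_{ij}|$. In the Word RAM model elementary operations on words take $O(1)$ time. *)

(* Defs.v *)
From mathcomp Require Import all_boot all_order all_algebra.
From mathcomp Require Import reals exp.

Set Implicit Arguments.
Unset Strict Implicit.
Unset Printing Implicit Defensive.

Import Order.TTheory GRing.Theory Num.Theory.
Local Open Scope ring_scope.

(** * Strings and distributions *)

Definition block (m n : nat) (x : (m * n).-tuple bool) (i : 'I_m) :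
  n.-tuple bool := [tuple nth false x (i * n + j) | j < n].

Definition blocks (m n : nat) (x : (m * n).-tuple bool) :
  m.-tuple (n.-tuple bool) := [tuple block x i | i < m].

(* A distribution on a finite type is represented by its mass function. *)
Definition uniform (R : realType) (T : finType) : T -> R :=
  fun=> #|T|%:R^-1.

Definition uniform_string (R : realType) (m n : nat) :
  m.-tuple (n.-tuple bool) -> R :=
  @uniform R (m.-tuple (n.-tuple bool) : finType).
Arguments uniform_string R m n : clear implicits.

Definition pushforward (R : realType) (S T : finType) (f : S -> T)
  (D : S -> R) : T -> R := fun y => \sum_(x | f x == y) D x.

Definition prg_dist (R : realType) (s m n : nat)
  (G : s.-tuple bool -> (m * n).-tuple bool) : m.-tuple (n.-tuple bool) -> R :=
  pushforward (fun r => blocks (G r)) (@uniform R (s.-tuple bool : finType)).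

(** * Finite state machines over the alphabet {0,1}^n *)

Record fsm (n : nat) := FSM {
  nstates : nat;
  trans : 'I_nstates -> n.-tuple bool -> 'I_nstates
}.

Definition final_state (n : nat) (Q : fsm n) (q : 'I_(nstates Q))
  (x : seq (n.-tuple bool)) : 'I_(nstates Q) := foldl (@trans n Q) q x.
Arguments final_state {n} Q q x.

Definition fsm_matrix (R : realType) (m n : nat) (Q : fsm n)
  (D : m.-tuple (n.-tuple bool) -> R) : 'M[R]_(nstates Q) :=
  \matrix_(i, j)
    \sum_(x : m.-tuple (n.-tuple bool) | final_state Q i x == j) D x.

Definition accept_prob (R : realType) (m n : nat) (Q : fsm n)
  (D : m.-tuple (n.-tuple bool) -> R) (q0 : 'I_(nstates Q))
  (A : {set 'I_(nstates Q)}) : R :=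
  \sum_(x : m.-tuple (n.-tuple bool) | final_state Q q0 x \in A) D x.

(* Not [mx_norm] of MathComp-Analysis, which is the largest entry. *)
Definition row_sum_norm (R : realType) (p q : nat) (M : 'M[R]_(p, q)) : R :=
  \big[Num.max/0]_(i < p) \sum_(j < q) `|M i j|.

(** * Word RAM with word size w *)

Local Open Scope nat_scope.

Inductive word_op :=
  OpAdd | OpSub | OpMul | OpDiv | OpMod | OpAnd | OpOr | OpXor | OpShl | OpShr.

(* Every result is reduced modulo 2 ^ w, so that registers and memory cells
   always hold w-bit words and only the addresses below 2 ^ w are accessible.
   Subtraction wraps around; x / 0 = 0 and x mod 0 = x. *)
Definition eval_op (w : nat) (o : word_op) (x y : nat) : nat :=
  (match o with
   | OpAdd => x + y
   | OpSub => x + 2 ^ w - y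
   | OpMul => x * y
   | OpDiv => x %/ y
   | OpMod => x %% y
   | OpAnd => Nat.land x y
   | OpOr  => Nat.lor x y
   | OpXor => Nat.lxor x y
   | OpShl => x * 2 ^ y
   | OpShr => x %/ 2 ^ y
   end) %% 2 ^ w.

Inductive instr :=
  | IConst of nat & nat               (* IConst d v    : R[d] := v             *)
  | IOp of word_op & nat & nat & nat  (* IOp o d x y   : R[d] := o R[x] R[y]   *)
  | ILoad of nat & nat                (* ILoad d a     : R[d] := M[R[a]]       *)
  | IStore of nat & nat               (* IStore a x    : M[R[a]] := R[x]       *)
  | IJump of nat                      (* IJump l       : goto l                *)
  | IJumpLt of nat & nat & nat.       (* IJumpLt x y l : if R[x] < R[y] goto l *)

Definition program := seq instr.

Record ram_state := RamState {
  pc : nat;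
  reg : nat -> nat;
  mem : nat -> nat
}.

(* A program counter outside the program means that the machine has halted. *)
Definition ram_step (w : nat) (P : program) (st : ram_state) : ram_state :=
  let: RamState l R M := st in
  match onth P l with
  | None => st
  | Some (IConst d v) => RamState l.+1 [eta R with d |-> v %% 2 ^ w] M
  | Some (IOp o d x y) =>
      RamState l.+1 [eta R with d |-> eval_op w o (R x) (R y)] M
  | Some (ILoad d a) => RamState l.+1 [eta R with d |-> M (R a)] M
  | Some (IStore a x) => RamState l.+1 R [eta M with R a |-> R x]
  | Some (IJump l') => RamState l' R M
  | Some (IJumpLt x y l') => RamState (if R x < R y then l' else l.+1) R M
  end.

(* Little-endian: bit j of the string has weight 2 ^ j. *)
Definition bits_val (x : seq bool) : nat :=
  \sum_(j < size x) nth false x j * 2 ^ j.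

(* The string r occupies the memory from address 0 on, packed w bits to the
   word; the remaining cells are 0.  The numerical inputs are in the first
   registers. *)
Definition ram_init (w : nat) (inputs : seq nat) (r : seq bool) : ram_state :=
  RamState 0 (fun j => nth 0 inputs j %% 2 ^ w)
             (fun a => bits_val (take w (drop (a * w) r))).

Definition ram_computes (w : nat) (P : program) (inputs : seq nat)
  (r : seq bool) (T v : nat) : Prop :=
  exists t : nat,
    let st := iter t (ram_step w P) (ram_init w inputs r) in
    [/\ t <= T, size P <= pc st & reg st 0 = v].

(* Main.v *)
Require Import Defs.
From mathcomp Require Import all_boot all_order all_algebra.
From mathcomp Require Import reals exp.
From mathcomp Require Import ring lra zify.

(** The generator is a b-ary version of Nisan's.  Let X = {0,1}^n.  A level
    consists of b independent pairwise independent hash functions X -> X, which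
    together form a pairwise independent function h : X -> X^b.  Labels are
    propagated from the root of a b-ary tree of depth k to its leaves, all the
    nodes of a level sharing the same h, and the b^k leaves are the output.

    Pairwise independence makes a random h a sampler: by the second moment,
    for every set A of X^b, the mean of 1_A(h(x)) over x differs from the
    density of A by at most |X|^(-1/2), on average over h.  Summed over all
    pairs of states, replacing the b blocks below a node by independent ones
    costs at most S^2 2^(-n/2), for any machine with S states.  Reading a whole
    subtree is again such a machine on the label of its root, and
    ||P^b - P'^b|| <= b ||P - P'|| for stochastic P and P', so that the errors
    of all levels add up to at most b^k S^2 2^(-n/2); take c = 1/8.

    Multiplication in the field with 2^n elements is not a Word RAM operation,
    so the hash functions are multiply-shift ones: the top n bits of
    a x + c mod 2^(2n). *)

Set Implicit Arguments.
Unset Strict Implicit.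
Unset Printing Implicit Defensive.

Import Order.TTheory GRing.Theory Num.Theory.
Local Open Scope ring_scope.

(** * Finite state machines as stochastic matrices *)

Lemma sum_tupleS (V : nmodType) (T : finType) m (F : m.+1.-tuple T -> V) :
  \sum_t F t = \sum_x \sum_(t : m.-tuple T) F [tuple of x :: t].
Proof.
rewrite pair_big (reindex (fun p : T * m.-tuple T => [tuple of p.1 :: p.2])) //=.
exists (fun t : m.+1.-tuple T => (thead t, [tuple of behead t])) => [[x t]|t] _.
  by rewrite theadE; congr (_, _); apply: val_inj.
by rewrite -tuple_eta.
Qed.

Lemma sum_tuple0 (V : nmodType) (T : finType) (F : 0.-tuple T -> V) :
  \sum_t F t = F [tuple].
Proof.
rewrite (big_pred1 [tuple]) // => t; apply/esym/eqP; exact: tuple0.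
Qed.

(** Stated over a possibly noncommutative ring, for use with square matrices. *)
Lemma sum_tuple_prod (A : pzRingType) (T : finType) m (F : T -> A) :
  \sum_(t : m.-tuple T) \prod_(x <- t) F x = (\sum_x F x) ^+ m.
Proof.
elim: m => [|m IH]; first by rewrite sum_tuple0 big_nil expr0.
rewrite sum_tupleS exprS -IH big_distrl; apply: eq_bigr => x _ /=.
by rewrite big_distrr; apply: eq_bigr => t _; rewrite big_cons.
Qed.

(** * The maximal row sum as a submultiplicative norm *)

Section RowSumNorm.
Variable R : realType.

Lemma row_sum_norm_le p q (M : 'M[R]_(p, q)) e :
  0 <= e -> (forall i, \sum_j `|M i j| <= e) -> row_sum_norm M <= e.
Proof. by move=> e0 h; apply/bigmax_le. Qed.

Lemma row_sum_le_norm p q (M : 'M[R]_(p, q)) i :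
  \sum_j `|M i j| <= row_sum_norm M.
Proof. exact: (le_bigmax _ (fun i => \sum_j `|M i j|)). Qed.

Lemma row_sum_norm_ge0 p q (M : 'M[R]_(p, q)) : 0 <= row_sum_norm M.
Proof. exact: bigmax_ge_id. Qed.

Lemma row_sum_normD p q (M M' : 'M[R]_(p, q)) :
  row_sum_norm (M + M') <= row_sum_norm M + row_sum_norm M'.
Proof.
apply: row_sum_norm_le => [|i]; first by rewrite addr_ge0 ?row_sum_norm_ge0.
apply: le_trans (lerD (row_sum_le_norm M i) (row_sum_le_norm M' i)).
by rewrite -big_split ler_sum // => j _; rewrite mxE ler_normD.
Qed.

Lemma row_sum_normZ p q a (M : 'M[R]_(p, q)) :
  row_sum_norm (a *: M) <= `|a| * row_sum_norm M.
Proof.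
apply: row_sum_norm_le => [|i]; first by rewrite mulr_ge0 ?row_sum_norm_ge0.
under eq_bigr do rewrite mxE normrM.
by rewrite -mulr_sumr ler_wpM2l ?row_sum_le_norm.
Qed.

Lemma row_sum_norm_sum (I : finType) p q (F : I -> 'M[R]_(p, q)) :
  row_sum_norm (\sum_i F i) <= \sum_i row_sum_norm (F i).
Proof.
elim/big_ind2: _ => // [|M1 a1 M2 a2 h1 h2].
  by apply: row_sum_norm_le => // i; rewrite big1 // => j _; rewrite mxE normr0.
exact: le_trans (row_sum_normD _ _) (lerD h1 h2).
Qed.

Lemma row_sum_normM p q r (M : 'M[R]_(p, q)) (M' : 'M[R]_(q, r)) :
  row_sum_norm (M *m M') <= row_sum_norm M * row_sum_norm M'.
Proof.
apply: row_sum_norm_le => [|i]; first by rewrite mulr_ge0 ?row_sum_norm_ge0.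
apply: (@le_trans _ _ (\sum_j \sum_k `|M i k| * `|M' k j|)).
  apply: ler_sum => j _; rewrite mxE; apply: le_trans (ler_norm_sum _ _ _) _.
  by apply: ler_sum => k _; rewrite normrM.
rewrite exchange_big; apply: le_trans (ler_wpM2r _ (row_sum_le_norm M i)).
  rewrite mulr_suml ler_sum // => k _.
  by rewrite -mulr_sumr ler_wpM2l ?row_sum_le_norm.
exact: row_sum_norm_ge0.
Qed.

Lemma row_sum_norm_exp p (M : 'M[R]_p) m :
  row_sum_norm M <= 1 -> row_sum_norm (M ^+ m) <= 1.
Proof.
move=> M1; elim: m => [|m IH].
  apply: row_sum_norm_le => // i; rewrite expr0 (bigD1 i) //= mxE eqxx normr1.
  by rewrite big1 ?addr0 // => j /negbTE ji; rewrite mxE eq_sym ji normr0.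
rewrite exprS; apply: le_trans (row_sum_normM _ _) _.
by rewrite mulr_ile1 ?row_sum_norm_ge0.
Qed.

(** Telescoping: the factors are exchanged one at a time, and each exchange costs at most the norm
    of [M - M'] because the other factors have norm at most 1. *)
Lemma row_sum_norm_expB p (M M' : 'M[R]_p) m :
  row_sum_norm M <= 1 -> row_sum_norm M' <= 1 ->
  row_sum_norm (M ^+ m - M' ^+ m) <= m%:R * row_sum_norm (M - M').
Proof.
move=> M1 M'1; elim: m => [|m IH].
  by rewrite !expr0 subrr mul0r row_sum_norm_le // => i;
     rewrite big1 // => j _; rewrite mxE normr0.
have -> : M ^+ m.+1 - M' ^+ m.+1 =
    M * (M ^+ m - M' ^+ m) + (M - M') * M' ^+ m.
  by rewrite !exprS mulrBr mulrBl addrA subrK.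
apply: le_trans (row_sum_normD _ _) _.
rewrite -[m.+1]addn1 natrD [leRHS]mulrDl mul1r lerD //;
  apply: le_trans (row_sum_normM _ _) _.
  by apply: le_trans IH; rewrite ler_piMl ?row_sum_norm_ge0.
by rewrite ler_piMr ?row_sum_norm_ge0 ?row_sum_norm_exp.
Qed.

End RowSumNorm.

(** * Averaged transition matrices *)

Section TransitionMatrix.
Variable R : realType.

Definition mean (T : finType) (F : T -> R) : R := #|T|%:R^-1 * \sum_x F x.

Definition transition_mx (S : nat) (T : finType) (f : 'I_S -> T -> 'I_S) :
  'M[R]_S := \matrix_(i, j) mean (fun x => (f i x == j)%:R).

Lemma mean_bij (T T' : finType) (f : T -> T') (F : T' -> R) :
  bijective f -> mean (fun x => F (f x)) = mean F.
Proof.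
move=> bf; rewrite /mean (bij_eq_card bf); congr (_ * _).
by rewrite [RHS](reindex f) //; apply: onW_bij.
Qed.

Lemma transition_mx_norm S (T : finType) (f : 'I_S -> T -> 'I_S) :
  row_sum_norm (transition_mx f) <= 1.
Proof.
apply: row_sum_norm_le => // i.
under eq_bigr do rewrite mxE normrM normfV !normr_nat.
rewrite -mulr_sumr.
rewrite (eq_bigr (fun j => \sum_x (f i x == j)%:R)); last first.
  by move=> j _; rewrite ger0_norm // sumr_ge0.
rewrite exchange_big (eq_bigr (fun=> 1)); last first.
  move=> x _; rewrite (bigD1 (f i x)) //= eqxx big1 ?addr0 // => j.
  by rewrite eq_sym => /negbTE ->.
rewrite sumr_const -[#|xpredT|]/#|T|.
(* An empty [T] gives the zero matrix, as the inverse of 0 is 0; otherwise each row sums to 1. *)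
have [->|T0] := eqVneq #|T| 0%N; first by rewrite invr0 mul0r.
by rewrite mulVf // pnatr_eq0.
Qed.

(** A word acts as the product of the 0/1 matrices [D x] of its letters, so averaging over all words
    amounts to expanding the power of the averaged matrix. *)
Lemma transition_mx_foldl S (T : finType) (f : 'I_S -> T -> 'I_S) m :
  transition_mx (fun i (t : m.-tuple T) => foldl f i t) = transition_mx f ^+ m.
Proof.
pose D x : 'M[R]_S := \matrix_(i, j) (f i x == j)%:R.
have prodD (s : seq T) :
    \prod_(x <- s) D x = \matrix_(i, j) (foldl f i s == j)%:R.
  elim: s => [|x s IH]; first by rewrite big_nil; apply/matrixP=> i j; rewrite !mxE.
  rewrite big_cons IH; apply/matrixP=> i j; rewrite !mxE.
  rewrite (bigD1 (f i x)) //= !mxE eqxx mul1r big1 ?addr0 // => k.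
  by rewrite !mxE eq_sym => /negbTE ->; rewrite mul0r.
have fE : transition_mx f = #|T|%:R^-1 *: \sum_x D x.
  apply/matrixP=> i j; rewrite !mxE summxE; congr (_ * _).
  by apply: eq_bigr => x _; rewrite mxE.
have scale_exp a (M : 'M[R]_S) : (a *: M) ^+ m = a ^+ m *: M ^+ m.
  elim: m => [|p IH]; first by rewrite !expr0 scale1r.
  by rewrite !exprS IH -[LHS]scalemxAl -[X in a *: X]scalemxAr scalerA.
rewrite fE scale_exp -sum_tuple_prod exprVn -natrX -card_tuple.
apply/matrixP=> i j; rewrite !mxE summxE; congr (_ * _).
by apply: eq_bigr => t _; rewrite prodD mxE.
Qed.

End TransitionMatrix.

(** * Accumulation of errors along the levels of the tree *)

Section Expansion.
Variables (X H : finType) (b : nat) (h : H -> X -> b.-tuple X).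

(** Leaf labels, from left to right, below a node labelled [x]; [gs] lists the levels from the top
    down. *)
Fixpoint expand (gs : seq H) (x : X) : seq X :=
  if gs is g :: gs' then flatten [seq expand gs' y | y <- h g x] else [:: x].

(** Seen from the root, a machine reading leaves is a machine reading b children, each of which
    triggers the reading of its whole subtree. *)
Lemma foldl_expand_cons S (f : 'I_S -> X -> 'I_S) g gs i x :
  foldl f i (expand (g :: gs) x) =
  foldl (fun j y => foldl f j (expand gs y)) i (h g x).
Proof.
rewrite /=; elim: (val (h g x)) i => //= y s IH i.
by rewrite foldl_cat IH.
Qed.

Variables (R : realType) (eps : R).
Hypothesis sampler : forall A : pred (b.-tuple X),
  \sum_g `|mean (fun x => (A (h g x))%:R) - mean (fun y => (A y)%:R)|
    <= #|H|%:R * eps.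

(** The norm is bounded by the sum of all S^2 entries, so that the average over [g] can be taken
    entry by entry. Each entry is the deviation of the sampler on the set of tuples leading from [i]
    to [j]. *)
Lemma expand_level S (f : 'I_S -> X -> 'I_S) :
  \sum_g row_sum_norm (transition_mx R (fun i x => foldl f i (h g x)) -
                       transition_mx R f ^+ b)
    <= #|H|%:R * (S%:R ^+ 2 * eps).
Proof.
apply: (@le_trans _ _ (\sum_g \sum_i \sum_j
   `|(transition_mx R (fun i x => foldl f i (h g x)) -
                       transition_mx R f ^+ b) i j|)).
  apply: ler_sum => g _; apply: row_sum_norm_le => [|i].
    by apply: sumr_ge0 => i _; apply: sumr_ge0.
  rewrite [leRHS](bigD1 i) //= lerDl.
  by apply: sumr_ge0 => ? _; apply: sumr_ge0.
rewrite exchange_big /=; under eq_bigr do rewrite exchange_big /=.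
apply: (@le_trans _ _ (\sum_(i < S) \sum_(j < S) #|H|%:R * eps)); last first.
  rewrite !sumr_const !card_ord -mulrnA -[leLHS]mulr_natl natrM.
  by rewrite mulrCA -expr2.
apply: ler_sum => i _; apply: ler_sum => j _.
apply: le_trans (sampler (fun y => foldl f i y == j)).
apply: ler_sum => g _; rewrite -transition_mx_foldl.
by rewrite !mxE.
Qed.

(** Averaged over the hash functions, the errors satisfy e(0) = 0 and e(k+1) <= delta + b e(k) with
    delta = S^2 eps, hence e(k) <= delta (b^k - 1) for b >= 2. *)
Lemma expand_error S (f : 'I_S -> X -> 'I_S) k : (1 < b)%N -> 0 <= eps ->
  \sum_(gs : k.-tuple H)
     row_sum_norm (transition_mx R (fun i x => foldl f i (expand gs x)) -
                   transition_mx R f ^+ (b ^ k))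
    <= #|H|%:R ^+ k * (S%:R ^+ 2 * eps * ((b ^ k)%:R - 1)).
Proof.
move=> b1 eps0; elim: k => [|k IH].
  rewrite [leRHS](_ : _ = 0) ?expn0 ?subrr ?mulr0 //.
  rewrite sum_tuple0 expr1 /= subrr.
  by apply: row_sum_norm_le => // i; rewrite big1 // => j _; rewrite mxE normr0.
rewrite sum_tupleS exchange_big /=.
pose P gs := transition_mx R (fun i x => foldl f i (expand gs x)).
apply: (@le_trans _ _ (\sum_(gs : k.-tuple H)
   (#|H|%:R * (S%:R ^+ 2 * eps) +
    #|H|%:R * (b%:R * row_sum_norm (P gs - transition_mx R f ^+ (b ^ k)))))).
  apply: ler_sum => gs _.
  apply: le_trans (lerD (expand_level (fun i x => foldl f i (expand gs x))) (lexx _)).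
  rewrite mulr_natl -[#|H|]/#|xpredT| -sumr_const -big_split.
  apply: ler_sum => g _ /=.
  set E := transition_mx R (fun i x => foldl _ i (flatten _)).
  have -> : E = transition_mx R
      (fun i x => foldl (fun j y => foldl f j (expand gs y)) i (h g x)).
    apply/matrixP=> i j; rewrite !mxE; congr (_ * _); apply: eq_bigr => x _.
    by rewrite -foldl_expand_cons.
  (* The hybrid [P gs ^+ b] has independent children, but still expands each of them with [gs]. *)
  rewrite -(subrKA (P gs ^+ b)).
  apply: le_trans (row_sum_normD _ _) _.
  apply: lerD; first exact: lexx.
  rewrite expnSr exprM; apply: row_sum_norm_expB.
    exact: transition_mx_norm.
  exact/row_sum_norm_exp/transition_mx_norm.
rewrite big_split /= sumr_const card_tuple -!mulr_sumr.
rewrite -[_ *+ (#|H| ^ k)]mulr_natl (natrX _ #|H|).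
have H0 : 0 <= #|H|%:R :> R by [].
apply: (@le_trans _ _ (#|H|%:R ^+ k * (#|H|%:R * (S%:R ^+ 2 * eps)) +
  #|H|%:R * (b%:R * (#|H|%:R ^+ k * (S%:R ^+ 2 * eps * ((b ^ k)%:R - 1)))))).
  by apply: lerD => //; rewrite !ler_wpM2l.
(* The slack in the induction is a nonnegative multiple of b - 2. *)
rewrite -subr_ge0 expnS natrM exprS.
rewrite [leRHS](_ : _ =
  #|H|%:R * #|H|%:R ^+ k * (S%:R ^+ 2 * eps) * (b%:R - 2)); last by ring.
by rewrite !mulr_ge0 ?exprn_ge0 // subr_ge0 ler_nat.
Qed.

End Expansion.

(** * Sampling with pairwise independent functions *)

Section Sampler.
Variables (R : realType) (X Y H : finType) (h : H -> X -> Y) (tr : Y -> Y -> Y).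
(** Pairwise independence is stated by symmetry, without counting: a permutation of the functions
    translates the two values by prescribed [al] and [be]. *)
Hypothesis tr_inj : forall y, injective (tr^~ y).
Hypothesis h_tr : forall x x' al be, x != x' -> exists s : H -> H,
  [/\ injective s, forall g, h (s g) x = tr al (h g x)
    & forall g, h (s g) x' = tr be (h g x')].

Lemma sum_translation (phi : Y -> R) y : \sum_al phi (tr al y) = \sum_z phi z.
Proof. by rewrite [RHS](reindex_inj (@tr_inj y)). Qed.

(* The translations carry the pair (h g x, h g x') to every pair of values while
   permuting the g, hence this pair is uniformly distributed. *)
Lemma decorrelation (phi : Y -> R) x x' : x != x' -> \sum_y phi y = 0 ->
  \sum_g phi (h g x) * phi (h g x') = 0.
Proof.
move=> xx' phi0; have [g0|g0] := pickP (predT : pred H); last first.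
  by rewrite big_pred0.
move=> _; set E := LHS.
have Y0 : #|Y|%:R != 0 :> R.
  by rewrite pnatr_eq0 -lt0n; apply/card_gt0P; exists (h g0 x).
suff : #|Y|%:R * (#|Y|%:R * E) = 0.
  by move/eqP; rewrite !mulf_eq0 (negbTE Y0) => /eqP.
have -> : #|Y|%:R * (#|Y|%:R * E) =
    \sum_al \sum_be \sum_g phi (tr al (h g x)) * phi (tr be (h g x')).
  rewrite mulr_natl -[#|Y|]/#|xpredT| -sumr_const; apply: eq_bigr => al _.
  rewrite mulr_natl -sumr_const; apply: eq_bigr => be _.
  have [s [s_inj s1 s2]] := h_tr al be xx'.
  by rewrite /E (reindex_inj s_inj); apply: eq_bigr => g _; rewrite s1 s2.
under eq_bigr do rewrite exchange_big.
rewrite exchange_big big1 //= => g _.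
rewrite -[LHS]/(\sum_al \sum_be phi (tr al (h g x)) * phi (tr be (h g x'))).
by under eq_bigr do rewrite -mulr_sumr sum_translation phi0 mulr0; rewrite big1.
Qed.

(** Expanding the square, the off-diagonal terms vanish by [decorrelation], and each of the |X|
    diagonal terms is at most |H|. *)
Lemma second_moment (phi : Y -> R) : \sum_y phi y = 0 ->
  (forall y, `|phi y| <= 1) ->
  \sum_g (\sum_x phi (h g x)) ^+ 2 <= #|X|%:R * #|H|%:R.
Proof.
move=> phi0 phi1.
under eq_bigr do rewrite expr2 mulr_suml.
rewrite exchange_big mulr_natl -[#|X|]/#|xpredT| -sumr_const /=.
apply: ler_sum => x _; under eq_bigr do rewrite mulr_sumr.
rewrite exchange_big (bigD1 x) //= [X in _ + X]big1 ?addr0; last first.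
  by move=> x' xx'; apply: decorrelation => //; rewrite eq_sym.
rewrite -[#|H|]/#|xpredT| -sumr_const; apply: ler_sum => g _.
by rewrite -expr2 -[leLHS]ger0_norm ?sqr_ge0 // normrX exprn_ile1.
Qed.

(** The second moment bound is applied to [phi], the indicator of [A] centred at its density
    [rho]. *)
Lemma sampler_of_translations (A : pred Y) : (0 < #|X|)%N -> (0 < #|Y|)%N ->
  \sum_g `|mean (R := R) (fun x => (A (h g x))%:R) - mean (R := R) (fun y => (A y)%:R)|
    <= #|H|%:R * (Num.sqrt #|X|%:R)^-1.
Proof.
move=> X0 Y0; set rho := mean (R := R) (fun y => (A y)%:R).
have X0' : #|X|%:R != 0 :> R by rewrite pnatr_eq0 -lt0n.
have Y0' : #|Y|%:R != 0 :> R by rewrite pnatr_eq0 -lt0n.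
pose phi y : R := (A y)%:R - rho.
have phi0 : \sum_y phi y = 0.
  rewrite sumrB sumr_const -[#|_|]/#|Y| -mulr_natl /rho /mean mulrA mulfV //.
  by rewrite mul1r subrr.
have rho01 : 0 <= rho <= 1.
  rewrite /rho /mean mulr_ge0 ?invr_ge0 ?sumr_ge0 //=.
  rewrite mulrC ler_pdivrMr ?ltr0n // mul1r -[#|Y|]/#|xpredT| -sumr_const.
  by apply: ler_sum => y _; rewrite lern1 leq_b1.
have phi1 y : `|phi y| <= 1.
  by rewrite /phi ler_norml; case: (A y) => /=; move: rho01 => /andP[]; lra.
have Zphi g : mean (R := R) (fun x => (A (h g x))%:R) - rho =
    #|X|%:R^-1 * \sum_x phi (h g x).
  rewrite sumrB sumr_const -[rho *+ _]/(rho *+ #|X|).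
  by rewrite -[rho *+ _]mulr_natl mulrBr mulKf.
set t := Num.sqrt #|X|%:R.
have t0 : 0 < t by rewrite sqrtr_gt0 ltr0n.
have t2 : t ^+ 2 = #|X|%:R by rewrite sqr_sqrtr.
(* AM-GM: |z| <= (t z^2 + 1/t) / 2 with z of typical size 1/t *)
apply: (@le_trans _ _ (\sum_g (t^-1 ^+ 3 * (\sum_x phi (h g x)) ^+ 2 + t^-1) / 2)).
  apply: ler_sum => g _; rewrite Zphi -t2; set z := \sum_x _.
  rewrite normrM ger0_norm ?invr_ge0 ?sqr_ge0 // -[z ^+ 2]real_normK ?num_real //.
  move: (normr_ge0 z); set a := `|z| => a0.
  have ti : 0 < t^-1 by rewrite invr_gt0.
  rewrite -exprVn; set u := t^-1 in ti *.
  rewrite -subr_ge0 [leRHS](_ : _ = u / 2 * (u * a - 1) ^+ 2); last by field.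
  by rewrite mulr_ge0 ?sqr_ge0 // divr_ge0 // ltW.
rewrite -mulr_suml big_split /= -mulr_sumr sumr_const.
rewrite -[t^-1 *+ _]/(t^-1 *+ #|H|) -[t^-1 *+ _]mulr_natl.
rewrite ler_pdivrMr // -[2]/(1 + 1) mulrDr mulr1 lerD2r.
rewrite [leRHS](_ : _ = t^-1 ^+ 3 * (t ^+ 2 * #|H|%:R)); last first.
  by field; rewrite gt_eqF.
rewrite ler_wpM2l ?exprn_ge0 ?invr_ge0 ?(ltW t0) // t2.
exact: second_moment.
Qed.

End Sampler.

(** * Multiply-shift hashing *)

Local Open Scope nat_scope.

(** [d] may be even, hence not invertible. But its gcd with 2^(2n) is a power of 2 that is at most d
    < 2^n, so it divides 2^n gam, and a Bezout coefficient of [d] can be scaled. *)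
Lemma solve_congruence n d gam : 0 < d < 2 ^ n ->
  exists a, a * d = 2 ^ n * gam %[mod (2 ^ n) ^ 2].
Proof.
move=> /andP[d0 dn]; set M := _ ^ 2.
case: (egcdnP M d0) => k l kl _.
have /dvdn_pfactor [//|m _ gE] : gcdn d M %| 2 ^ (n * 2).
  by rewrite expnM dvdn_gcdr.
have mn : m <= n.
  by rewrite -(leq_exp2l _ _ (ltnSn 1)) -gE ltnW ?(leq_ltn_trans _ dn) //
    dvdn_leq ?dvdn_gcdl.
exists (k * (2 ^ (n - m) * gam)).
rewrite mulnAC kl gE mulnDl [2 ^ m * _]mulnA -expnD subnKC //.
by rewrite mulnAC modnMDl.
Qed.

(* Multiply-shift hashing of Dietzfelbinger: u encodes the pair (a, c) of
   residues modulo N ^ 2, and x is sent to the top half of a * x + c. *)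
Definition mshash (N u x : nat) : nat :=
  ((u %% N ^ 2 * x + u %/ N ^ 2) %% N ^ 2) %/ N.

Lemma mshash_lt N u x : 0 < N -> mshash N u x < N.
Proof.
by move=> N0; rewrite ltn_divLR // mulnn ltn_mod expn_gt0 N0.
Qed.

(** Adding a multiple of N leaves the low half alone, so no carry reaches the top half. *)
Lemma top_half_shift N z z' al : 0 < N -> z' = z + N * al %[mod N ^ 2] ->
  (z' %% N ^ 2) %/ N = ((z %% N ^ 2) %/ N + al) %% N.
Proof.
move=> N0 ->; rewrite -mulnn -!modn_divl modnDml addnC [N * al]mulnC.
by rewrite divnMDl // addnC.
Qed.

(** The map y -> a0 y + c0 has to take the values N al at x and N be at x', modulo N^2: the slope
    solves a0 (x' - x) = N (be - al), and then c0 = N al - a0 x. *)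
Lemma mshash_translation n x x' al be : x < x' < 2 ^ n ->
  exists a0 c0, forall a c, let N := 2 ^ n in
    ((a + a0) * x + (c + c0) = a * x + c + N * al %[mod N ^ 2]) /\
    ((a + a0) * x' + (c + c0) = a * x' + c + N * be %[mod N ^ 2]).
Proof.
move=> /andP[xx' x'N]; pose N := 2 ^ n.
(* The truncation-free substitute for be - al; after multiplication by N the two differ by N^2
   al. *)
have [|a0 a0E] := @solve_congruence n (x' - x) (be + (N * al - al)).
  by rewrite subn_gt0 xx' (leq_ltn_trans (leq_subr _ _)).
(* The factor [(N ^ 2).-1] is -1 modulo N^2. *)
exists a0, (N * al + a0 * x * (N ^ 2).-1) => a c.
have N20 : 0 < N ^ 2 by rewrite !expn_gt0.
have E y : (a + a0) * y + (c + (N * al + a0 * x * (N ^ 2).-1)) =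
    a * y + c + (a0 * y + (N * al + a0 * x * (N ^ 2).-1)) by ring.
have Ex : a0 * x + (N * al + a0 * x * (N ^ 2).-1) = a0 * x * N ^ 2 + N * al.
  by rewrite -[in RHS](prednK N20) mulnS; ring.
have Ed : a0 * (x' - x) + N * al = N * be %[mod N ^ 2].
  rewrite -modnDml a0E modnDml -/N.
  have alN : al <= N * al by rewrite leq_pmull // expn_gt0.
  rewrite -mulnDr -addnA subnK // mulnDr [N * (N * _)]mulnA mulnn [N ^ 2 * _]mulnC.
  by rewrite addnC modnMDl.
rewrite /= !E; split; first by rewrite Ex -modnDmr modnMDl modnDmr.
rewrite -[in a0 * x'](subnK (ltnW xx')) mulnDr.
rewrite -[a0 * _ + _ + _]addnA Ex [a0 * _ + _]addnCA -modnDmr modnMDl.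
by rewrite Ed modnDmr.
Qed.

Section HashLevel.
Variables (n b : nat).
Local Notation N := (2 ^ n).

Fact N_gt0 : 0 < N. Proof. by rewrite expn_gt0. Qed.

Definition hash_word (u : 'I_((N ^ 2) ^ 2)) (x : 'I_N) : 'I_N :=
  Ordinal (mshash_lt u x N_gt0).

Definition hash_level (g : b.-tuple 'I_((N ^ 2) ^ 2)) (x : 'I_N) :
  b.-tuple 'I_N := [tuple hash_word (tnth g d) x | d < b].

Definition ord_shift m (i al : 'I_m) : 'I_m :=
  Ordinal (ltn_pmod (i + al) (leq_ltn_trans (leq0n i) (ltn_ord i))).

Lemma ord_shift_inj m (i : 'I_m) : injective (ord_shift i).
Proof.
move=> j k [] /eqP; rewrite eqn_modDl !modn_small // => /eqP; exact: val_inj.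
Qed.

Lemma hash_word_shift x x' (al be : 'I_N) : x != x' ->
  exists s : 'I_((N ^ 2) ^ 2) -> 'I_((N ^ 2) ^ 2),
  [/\ injective s, forall u, hash_word (s u) x = ord_shift (hash_word u x) al
    & forall u, hash_word (s u) x' = ord_shift (hash_word u x') be].
Proof.
move=> xx'; wlog lt_xx' : x x' al be xx' / x < x'.
  move=> H; case: (ltngtP x x') => [|x'x|/val_inj xE]; first exact: H.
    have [|s [si s1 s2]] := H x' x be al _ x'x; first by rewrite eq_sym.
    by exists s; split.
  by rewrite xE eqxx in xx'.
have [a0 [c0 ac0]] : exists a0 c0, forall a c,
    ((a + a0) * x + (c + c0) = a * x + c + N * al %[mod N ^ 2]) /\
    ((a + a0) * x' + (c + c0) = a * x' + c + N * be %[mod N ^ 2]).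
  by apply: mshash_translation; rewrite lt_xx' /=.
have M0 : 0 < N ^ 2 by rewrite !expn_gt0.
(* The base N^2 digits of [u] are shifted separately, a (low) by [a0] and c (high) by [c0]; without
   a carry between them, both shifts can be undone. *)
pose v (u : nat) := (u %/ N ^ 2 + c0) %% N ^ 2 * N ^ 2 + (u %% N ^ 2 + a0) %% N ^ 2.
have vmod u : v u %% N ^ 2 = (u %% N ^ 2 + a0) %% N ^ 2.
  by rewrite modnMDl modn_mod.
have vdiv u : v u %/ N ^ 2 = (u %/ N ^ 2 + c0) %% N ^ 2.
  by rewrite divnMDl // [X in _ + X]divn_small ?addn0 // ltn_mod.
have v_lt u : v u < (N ^ 2) ^ 2.
  by rewrite -[(N ^ 2) ^ 2]mulnn -ltn_divLR // vdiv ltn_mod.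
have vshift u (y be' : 'I_N) : (forall a c, (a + a0) * y + (c + c0) =
      a * y + c + N * be' %[mod N ^ 2]) ->
    mshash N (v u) y = (mshash N u y + be') %% N.
  move=> ac; apply: top_half_shift N_gt0 _.
  by rewrite vmod vdiv modnDmr -modnDml modnMml modnDml ac.
exists (fun u => Ordinal (v_lt u)); split=> [u u' [E]|u|u]; apply: val_inj => /=.
- have u_lt (w : 'I_((N ^ 2) ^ 2)) : w %/ N ^ 2 < N ^ 2.
    by rewrite ltn_divLR // mulnn.
  rewrite [LHS](divn_eq _ (N ^ 2)) [RHS](divn_eq _ (N ^ 2)).
  have := vmod u; rewrite E vmod => /eqP; rewrite eqn_modDr !modn_mod => /eqP ->.
  have := vdiv u; rewrite E vdiv => /eqP; rewrite eqn_modDr.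
  by rewrite (modn_small (u_lt u)) (modn_small (u_lt u')) => /eqP ->.
- by apply: vshift => a c; case: (ac0 a c).
- by apply: vshift => a c; case: (ac0 a c).
Qed.

(** The b functions of a level are independent, so tuples are translated coordinate by
    coordinate. *)
Lemma hash_level_sampler (R : realType) (A : pred (b.-tuple 'I_N)) :
  (\sum_g `|mean (R := R) (fun x => (A (hash_level g x))%:R) -
            mean (fun y => (A y)%:R)|
    <= #|{: b.-tuple 'I_((N ^ 2) ^ 2)}|%:R * (Num.sqrt N%:R)^-1)%R.
Proof.
rewrite -[X in Num.sqrt X%:R](card_ord N).
pose tr (al y : b.-tuple 'I_N) := [tuple ord_shift (tnth y d) (tnth al d) | d < b].
apply: (@sampler_of_translations R _ _ _ hash_level tr).
- move=> y al al' E; apply: eq_from_tnth => d.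
  apply: (@ord_shift_inj _ (tnth y d)).
  by have := congr1 (fun t => tnth t d) E; rewrite !tnth_mktuple.
- move=> x x' al be xx'.
  have /fin_all_exists [s sP] d := hash_word_shift (tnth al d) (tnth be d) xx'.
  exists (fun g => [tuple s d (tnth g d) | d < b]); split=> [g g' E|g|g].
  + apply: eq_from_tnth => d; case: (sP d) => s_inj _ _; apply: s_inj.
    by have := congr1 (fun t => tnth t d) E; rewrite !tnth_mktuple.
  + by apply: eq_from_tnth => d; rewrite !tnth_mktuple; case: (sP d).
  + by apply: eq_from_tnth => d; rewrite !tnth_mktuple; case: (sP d).
- by rewrite card_ord N_gt0.
- by rewrite card_tuple card_ord !expn_gt0.
Qed.

End HashLevel.

(** * The generator *)

Lemma bits_val_cons a s : bits_val (a :: s) = a + 2 * bits_val s.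
Proof.
rewrite /bits_val /= big_ord_recl /= muln1 big_distrr /=; congr (_ + _).
by apply: eq_bigr => j _; rewrite /bump add1n expnS mulnCA.
Qed.

Lemma bits_val_nil : bits_val [::] = 0.
Proof. by rewrite /bits_val big_ord0. Qed.

Lemma bits_val_lt s : bits_val s < 2 ^ size s.
Proof.
elim: s => [|a s IH]; first by rewrite bits_val_nil.
rewrite bits_val_cons /= expnS; case: a => /=; lia.
Qed.

Lemma bits_val_cat s s' :
  bits_val (s ++ s') = bits_val s + 2 ^ size s * bits_val s'.
Proof.
elim: s => [|a s IH]; first by rewrite bits_val_nil mul1n.
by rewrite /= !bits_val_cons IH expnS mulnDr addnA mulnA.
Qed.

Lemma bits_val_drop o s : bits_val (drop o s) = bits_val s %/ 2 ^ o.
Proof.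
have [so|os] := leqP (size s) o.
  by rewrite drop_oversize // bits_val_nil divn_small //
    (leq_trans (bits_val_lt s)) ?leq_exp2l.
rewrite -[in RHS](cat_take_drop o s) bits_val_cat addnC mulnC.
rewrite size_takel ?(ltnW os) // divnMDl ?expn_gt0 // divn_small ?addn0 //.
by rewrite (leq_trans (bits_val_lt _)) // size_takel // ltnW.
Qed.

Lemma bits_val_take m s : bits_val (take m s) = bits_val s %% 2 ^ m.
Proof.
have [sm|ms] := leqP (size s) m.
  by rewrite take_oversize // modn_small // (leq_trans (bits_val_lt s)) ?leq_exp2l.
rewrite -[in RHS](cat_take_drop m s) bits_val_cat addnC mulnC.
rewrite size_takel ?(ltnW ms) // modnMDl modn_small //.
by rewrite (leq_trans (bits_val_lt _)) // size_takel // ltnW.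
Qed.

Lemma bits_val_inj s s' : size s = size s' -> bits_val s = bits_val s' -> s = s'.
Proof.
elim: s s' => [|a s IH] [|a' s'] //= [Es]; rewrite !bits_val_cons => E.
have aE : a = a' by case: a a' E => [] []; lia.
by rewrite aE in E *; rewrite (IH s') //; lia.
Qed.

Definition to_bits (n v : nat) : n.-tuple bool := [tuple odd (v %/ 2 ^ j) | j < n].

Lemma bits_val_to_bits n v : v < 2 ^ n -> bits_val (to_bits n v) = v.
Proof.
rewrite /= -[map _ _]/(codom (fun j : 'I_n => odd (v %/ 2 ^ j))).
suff -> : codom (fun j : 'I_n => odd (v %/ 2 ^ j)) = mkseq (fun j => odd (v %/ 2 ^ j)) n.
  elim: n v => [|n IH] v; first by rewrite bits_val_nil; case: v.
  rewrite /mkseq /= bits_val_cons expn0 divn1 => v_lt.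
  rewrite (iotaDl 1 0) -map_comp.
  rewrite (eq_map (g := fun j => odd ((v %/ 2) %/ 2 ^ j))).
    by rewrite -/(mkseq _ n) IH ?ltn_divLR -?expnSr // mulnC -modn2 addnC -divn_eq.
  by move=> j /=; rewrite add1n expnS divnMA.
by rewrite codomE /mkseq -val_enum_ord -map_comp.
Qed.

Definition bits_of_ord n (x : 'I_(2 ^ n)) : n.-tuple bool := to_bits n x.

Lemma bits_of_ord_bij n : bijective (@bits_of_ord n).
Proof.
apply: inj_card_bij; last by rewrite card_tuple card_bool card_ord.
move=> x y E; apply: val_inj => /=.
by rewrite -(bits_val_to_bits (ltn_ord x)) -(bits_val_to_bits (ltn_ord y))
  -!/(bits_of_ord _) E.
Qed.

Lemma digits_inj m J v v' : v < 2 ^ (m * J) -> v' < 2 ^ (m * J) ->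
  (forall j, j < J -> v %/ 2 ^ (m * j) = v' %/ 2 ^ (m * j) %[mod 2 ^ m]) -> v = v'.
Proof.
elim: J v v' => [|J IH] v v'; first by rewrite muln0; case: v v' => [|?] [].
rewrite mulnS expnD => v_lt v'_lt E.
have := E 0 isT; rewrite muln0 !divn1 => E0.
rewrite (divn_eq v (2 ^ m)) (divn_eq v' (2 ^ m)) E0; congr (_ * _ + _).
apply: IH => [||j jJ]; try by rewrite ltn_divLR ?expn_gt0 // [ltnRHS]mulnC.
by rewrite -!divnMA -!expnD -mulnS; apply: E.
Qed.

Section Generator.
Variables (n b k : nat).
Local Notation N := (2 ^ n).
Local Notation word := 'I_((N ^ 2) ^ 2).

(* The seed consists of n bits for the root of the tree, followed by 4n bits
   for each of the k * b hash functions, the top level of the tree first. *)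
Definition seed_size := n + n * 4 * (k * b).

Definition seed_word (v j : nat) : nat := v %/ 2 ^ (n + n * 4 * j) %% 2 ^ (n * 4).

Fact seed_root_lt v : v %% N < N.
Proof. by rewrite ltn_mod expn_gt0. Qed.

Fact seed_word_lt v j : seed_word v j < (N ^ 2) ^ 2.
Proof. by rewrite -!expnM ltn_mod expn_gt0. Qed.

Definition seed_root (r : seed_size.-tuple bool) : 'I_N :=
  Ordinal (seed_root_lt (bits_val r)).

Definition seed_hashes (r : seed_size.-tuple bool) : k.-tuple (b.-tuple word) :=
  [tuple [tuple Ordinal (seed_word_lt (bits_val r) (l * b + d)) | d < b] | l < k].

(** Turns a uniform seed into a uniform root label and independent uniform hash functions. *)
Lemma seed_bij : bijective (fun r => (seed_root r, seed_hashes r)).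
Proof.
apply: inj_card_bij; last first.
  rewrite card_prod !card_tuple card_ord card_bool card_ord -!expnM -expnD.
  by apply: eq_leq; congr (_ ^ _); rewrite /seed_size; ring.
move=> r r' E; have Eroot : bits_val r = bits_val r' %[mod N].
  exact: (congr1 (fun p => val p.1) E).
have Ehash : seed_hashes r = seed_hashes r' := congr1 snd E.
have rN (t : seed_size.-tuple bool) : bits_val t %/ N < 2 ^ (n * 4 * (k * b)).
  rewrite ltn_divLR ?expn_gt0 // -expnD addnC.
  by have := bits_val_lt t; rewrite size_tuple.
apply: val_inj; apply: bits_val_inj; first by rewrite !size_tuple.
rewrite [LHS](divn_eq _ N) [RHS](divn_eq _ N) Eroot; congr (_ * _ + _).
apply: (digits_inj (rN r) (rN r')) => j jkb.
have b0 : 0 < b by case: b jkb => //; rewrite muln0.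
have jb : j %/ b < k by rewrite ltn_divLR.
have := congr1 (fun t => tnth (tnth t (Ordinal jb)) (Ordinal (ltn_pmod j b0))) Ehash.
rewrite !tnth_mktuple /= => -[]; rewrite /seed_word -divn_eq.
by rewrite -!divnMA -!expnD.
Qed.

Definition prg_leaves (r : seed_size.-tuple bool) : seq 'I_N :=
  expand (@hash_level n b) (seed_hashes r) (seed_root r).

Definition prg_block (r : seed_size.-tuple bool) (i : nat) : n.-tuple bool :=
  bits_of_ord (nth (seed_root r) (prg_leaves r) i).

Definition fast_prg (r : seed_size.-tuple bool) : (b ^ k * n).-tuple bool :=
  [tuple nth false (prg_block r (j %/ n)) (j %% n) | j < b ^ k * n].

Lemma block_fast_prg r (i : 'I_(b ^ k)) : block (fast_prg r) i = prg_block r i.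
Proof.
apply: eq_from_tnth => j; rewrite tnth_mktuple.
have n0 : 0 < n by apply: leq_trans (ltn_ord j).
have ij : i * n + j < b ^ k * n.
  rewrite (@leq_trans (i.+1 * n)) ?leq_mul // mulSn addnC ltn_add2r //.
rewrite -[i * n + j]/(val (Ordinal ij)) -tnth_nth tnth_mktuple.
by rewrite divnMDl // divn_small // addn0 modnMDl modn_small // (tnth_nth false).
Qed.

Lemma size_expand (X H : finType) (h : H -> X -> b.-tuple X) gs x :
  size (expand h gs x) = b ^ size gs.
Proof.
elim: gs x => //= g gs IH x; rewrite size_flatten /shape -map_comp.
have E : size \o expand h gs =1 fun=> b ^ size gs by move=> y; apply: IH.
rewrite (eq_map E).
rewrite expnS -[X in _ = X * _](size_tuple (h g x)).
by elim: (val (h g x)) => //= y s ->; rewrite mulSn.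
Qed.

Lemma blocks_fast_prg r :
  blocks (fast_prg r) = [seq bits_of_ord x | x <- prg_leaves r] :> seq _.
Proof.
have sz : size (prg_leaves r) = b ^ k by rewrite size_expand size_tuple.
apply: (@eq_from_nth _ (to_bits n 0)); first by rewrite size_tuple size_map sz.
move=> i; rewrite size_tuple => ik.
rewrite -[i]/(val (Ordinal ik)) -tnth_nth tnth_mktuple block_fast_prg.
by rewrite (nth_map (seed_root r)) // sz.
Qed.

End Generator.

(** * Error of the generator against a finite state machine *)

Section Fooling.
Variables (R : realType) (n b k : nat) (Q : fsm n).
Local Open Scope ring_scope.
Local Notation S := (nstates Q).
Local Notation H := (b.-tuple 'I_(((2 ^ n) ^ 2) ^ 2)).

Let f (q : 'I_S) (x : 'I_(2 ^ n)) : 'I_S := trans q (bits_of_ord x).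

Lemma fsm_matrix_uniform m :
  fsm_matrix Q (uniform_string R m n) = transition_mx R f ^+ m.
Proof.
have -> : transition_mx R f = transition_mx R (@trans n Q).
  apply/matrixP=> i j; rewrite !mxE.
  exact: (mean_bij (fun y => (trans i y == j)%:R) (@bits_of_ord_bij n)).
rewrite -transition_mx_foldl; apply/matrixP=> i j; rewrite !mxE.
rewrite /mean mulr_sumr [LHS]big_mkcond; apply: eq_bigr => x _.
by rewrite /final_state; case: eqP; rewrite ?mulr1 ?mulr0.
Qed.

Lemma final_state_prg i (r : (seed_size n b k).-tuple bool) :
  final_state Q i (blocks (fast_prg r)) = foldl f i (prg_leaves r).
Proof.
rewrite blocks_fast_prg /final_state.
by elim: (prg_leaves r) i => //= x s IH i; rewrite IH.
Qed.

(** With the hash functions fixed, averaging over the root label gives the transition matrix of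
    reading the whole tree. The average over the hash functions stays outside, ready for the
    triangle inequality. *)
Lemma fsm_matrix_prg :
  fsm_matrix Q (prg_dist R (@fast_prg n b k)) =
  #|{: k.-tuple H}|%:R^-1 *: \sum_(gs : k.-tuple H)
    transition_mx R (fun i x => foldl f i (expand (@hash_level n b) gs x)).
Proof.
apply/matrixP=> i j; rewrite !mxE summxE.
have -> : \sum_(x : (b ^ k).-tuple (n.-tuple bool) |
    final_state Q i x == j) prg_dist R (@fast_prg n b k) x =
    mean (fun r : (seed_size n b k).-tuple bool =>
      (foldl f i (prg_leaves r) == j)%:R : R).
  rewrite /mean mulr_sumr (eq_bigr (fun r => if foldl f i (prg_leaves r) == j
    then uniform R r else 0)); last by move=> r _; case: eqP; rewrite ?mulr1 ?mulr0.
  (* Seeds are grouped by the string that they generate. *)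
  rewrite -big_mkcond /= (partition_big (fun r => blocks (fast_prg r))
    (fun x : (b ^ k).-tuple (n.-tuple bool) => final_state Q i x == j)); last first.
    by move=> r; rewrite final_state_prg.
  apply: eq_bigr => x xj; apply: eq_bigl => r.
  case: (blocks (fast_prg r) =P x) => [xE|]; rewrite ?andbF // andbT.
  by rewrite -final_state_prg xE xj.
rewrite (mean_bij (fun p : 'I_(2 ^ n) * k.-tuple H =>
  (foldl f i (expand (@hash_level n b) p.2 p.1) == j)%:R) (@seed_bij n b k)).
rewrite /mean card_prod natrM invfM [_^-1 * _^-1]mulrC -mulrA; congr (_ * _).
rewrite -(pair_bigA _ (fun x (gs : k.-tuple H) =>
  (foldl f i (expand (@hash_level n b) gs x) == j)%:R)) exchange_big mulr_sumr.
by apply: eq_bigr => gs _; rewrite mxE.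
Qed.

Lemma prg_error : (1 < b)%N ->
  row_sum_norm (fsm_matrix Q (prg_dist R (@fast_prg n b k)) -
                fsm_matrix Q (uniform_string R (b ^ k) n))
    <= S%:R ^+ 2 * (Num.sqrt (2 ^ n)%:R)^-1 * (b ^ k)%:R.
Proof.
move=> b1; rewrite fsm_matrix_prg fsm_matrix_uniform.
set E := transition_mx R f ^+ _; set h := #|_|%:R.
have h0 : 0 < h by rewrite ltr0n card_tuple card_tuple card_ord !expn_gt0.
have eps0 : 0 <= (Num.sqrt (2 ^ n)%:R)^-1 :> R by rewrite invr_ge0 sqrtr_ge0.
(* The uniform side becomes an average of constants, to be compared term by term. *)
have -> : E = h^-1 *: \sum_(gs : k.-tuple H) E.
  by rewrite sumr_const -scaler_nat scalerA mulVf ?scale1r // gt_eqF.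
rewrite -scalerBr -sumrB; apply: le_trans (row_sum_normZ _ _) _.
rewrite ger0_norm ?invr_ge0 ?(ltW h0) // mulrC ler_pdivrMr //.
apply: le_trans (row_sum_norm_sum _) _.
apply: le_trans (expand_error (@hash_level_sampler n b R) f k b1 eps0) _.
rewrite [leRHS]mulrC /h (card_tuple k) (natrX _ #|_|) ler_wpM2l ?exprn_ge0 //.
by rewrite ler_wpM2l ?mulr_ge0 ?exprn_ge0 // gerBl.
Qed.

End Fooling.

(** * The Word RAM program *)

(* R0 = n, R1 = b, R2 = k, R3 = index of the leaf below the current node,
   R4 = w, R5 = 1, R6 = N, R7 = N ^ 2, R8 = N ^ 4, R9 = 4n, R10 = counter,
   R11 = label of the current node, R12 = number of leaves below it. *)
Definition prg_program : program :=
  [:: IConst 5 1;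
      IOp OpShl 6 5 0;
      IOp OpMul 7 6 6;
      IOp OpMul 8 7 7;
      IConst 9 4;
      IOp OpMul 9 0 9;
      IConst 10 0;
      ILoad 11 10;
      IOp OpMod 11 11 6;
      IConst 12 1;
      IOp OpMul 12 12 1;    (* 10: R12 := b ^ k *)
      IOp OpAdd 10 10 5;
      IJumpLt 10 2 10;
      IConst 10 0;
      IOp OpDiv 12 12 1;    (* 14: descend to the child R13 *)
      IOp OpDiv 13 3 12;
      IOp OpMod 3 3 12;
      IOp OpMul 14 10 1;    (* R14 := position of the hash function *)
      IOp OpAdd 14 14 13;
      IOp OpMul 14 14 9;
      IOp OpAdd 14 14 0;
      IOp OpDiv 15 14 4;    (* R16 := the 4n seed bits from R14 on *)
      IOp OpMod 14 14 4;
      ILoad 16 15;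
      IOp OpShr 16 16 14;
      IOp OpAdd 15 15 5;
      ILoad 17 15;
      IOp OpSub 14 4 14;
      IOp OpShl 17 17 14;
      IOp OpAdd 16 16 17;
      IOp OpMod 16 16 8;
      IOp OpMod 17 16 7;    (* R11 := mshash R6 R16 R11 *)
      IOp OpDiv 16 16 7;
      IOp OpMul 17 17 11;
      IOp OpAdd 17 17 16;
      IOp OpMod 17 17 7;
      IOp OpDiv 11 17 6;
      IOp OpAdd 10 10 5;
      IJumpLt 10 2 14;
      IConst 0 0;
      IOp OpAdd 0 0 11].


(** * Symbolic execution with exact step counts *)

Section Reach.
Variables (w : nat) (P : program) (M : nat -> nat).

(** Registers past the end of the list are unconstrained. *)
Definition regs (vs : seq nat) (R : nat -> nat) : Prop :=
  forall j, j < size vs -> R j = nth 0 vs j.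

(** The memory [M] stays fixed, as [prg_program] never stores. *)
Definition reach (l : nat) (vs : seq nat) (t l' : nat) (vs' : seq nat) : Prop :=
  forall R, regs vs R -> exists2 R', regs vs' R' &
    iter t (ram_step w P) (RamState l R M) = RamState l' R' M.

Lemma reach0 l vs : reach l vs 0 l vs.
Proof. by move=> R; exists R. Qed.

Lemma reach_trans l2 vs2 t1 t2 l1 vs1 l3 vs3 :
  reach l1 vs1 t1 l2 vs2 -> reach l2 vs2 t2 l3 vs3 ->
  reach l1 vs1 (t2 + t1) l3 vs3.
Proof.
move=> r1 r2 R /r1 [R2 /r2 [R3 R3E E2] E1]; exists R3 => //.
by rewrite iterD E1.
Qed.

Lemma regs_set vs R d v : d < size vs -> regs vs R ->
  regs (set_nth 0 vs d v) [eta R with d |-> v].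
Proof.
move=> dvs RE j; rewrite size_set_nth (maxn_idPr dvs) => jvs.
by rewrite nth_set_nth /=; case: eqP => // _; apply: RE.
Qed.

(** Peels off the first instruction; [v] is a parameter so that the result can be supplied in
    simplified form. *)
Lemma reach_op v l o d x y vs t l' vs' :
  onth P l = Some (IOp o d x y) ->
  [&& d < size vs, x < size vs & y < size vs] ->
  eval_op w o (nth 0 vs x) (nth 0 vs y) = v ->
  reach l.+1 (set_nth 0 vs d v) t l' vs' -> reach l vs t.+1 l' vs'.
Proof.
move=> Pl /and3P[dvs xvs yvs] <- H R RE.
have [R' R'E E] := H _ (regs_set dvs RE).
by exists R' => //; rewrite iterSr /= Pl !RE.
Qed.

Lemma reach_const v l d vs t l' vs' :
  onth P l = Some (IConst d v) -> d < size vs -> v < 2 ^ w ->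
  reach l.+1 (set_nth 0 vs d v) t l' vs' -> reach l vs t.+1 l' vs'.
Proof.
move=> Pl dvs vw H R RE.
have [R' R'E E] := H _ (regs_set dvs RE).
by exists R' => //; rewrite iterSr /= Pl modn_small.
Qed.

Lemma reach_load v l d a vs t l' vs' :
  onth P l = Some (ILoad d a) -> (d < size vs) && (a < size vs) ->
  M (nth 0 vs a) = v ->
  reach l.+1 (set_nth 0 vs d v) t l' vs' -> reach l vs t.+1 l' vs'.
Proof.
move=> Pl /andP[dvs avs] <- H R RE.
have [R' R'E E] := H _ (regs_set dvs RE).
by exists R' => //; rewrite iterSr /= Pl RE.
Qed.

Lemma reach_jump_lt l x y j vs t l' vs' :
  onth P l = Some (IJumpLt x y j) -> (x < size vs) && (y < size vs) ->
  reach (if nth 0 vs x < nth 0 vs y then j else l.+1) vs t l' vs' ->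
  reach l vs t.+1 l' vs'.
Proof.
move=> Pl /andP[xvs yvs] H R RE.
have [R' R'E E] := H _ RE.
by exists R' => //; rewrite iterSr /= Pl !RE.
Qed.

End Reach.

(** A field of m <= w bits meets at most two consecutive words. If [o %% w] is 0, the second word is
    shifted by w places and vanishes modulo 2^m, so the program can do without a branch. *)
Lemma read_bits v w m o : m <= w -> o %% w < w ->
  ((v %/ 2 ^ (o %/ w * w) %% 2 ^ w) %/ 2 ^ (o %% w) +
   (v %/ 2 ^ ((o %/ w + 1) * w) %% 2 ^ w) * 2 ^ (w - o %% w)) %% 2 ^ m =
  v %/ 2 ^ o %% 2 ^ m.
Proof.
move=> mw; rewrite [in RHS](divn_eq o w) mulnDl mul1n !expnD !divnMA.
move: (o %% w) => t tw; set a := v %/ _.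
have mdvd : 2 ^ m %| 2 ^ w by rewrite dvdn_exp2l.
rewrite -modnDmr -modnMml modn_dvdm // modnMml modnDmr.
rewrite [in RHS](divn_eq a (2 ^ w)) -[in X in _ * X + _](subnK (ltnW tw)).
by rewrite expnD mulnA divnMDl ?expn_gt0 // addnC.
Qed.

Section Eval.
Variable w : nat.

Lemma eval_add x y : x + y < 2 ^ w -> eval_op w OpAdd x y = x + y.
Proof. exact: modn_small. Qed.

Lemma eval_mul x y : x * y < 2 ^ w -> eval_op w OpMul x y = x * y.
Proof. exact: modn_small. Qed.

Lemma eval_sub x y : y <= x -> x < 2 ^ w -> eval_op w OpSub x y = x - y.
Proof.
move=> yx xw; rewrite /eval_op addnC -addnBA // modnDl modn_small //.
exact: leq_ltn_trans (leq_subr _ _) xw.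
Qed.

Lemma eval_div x y : x < 2 ^ w -> eval_op w OpDiv x y = x %/ y.
Proof. by move=> xw; apply: modn_small; apply: leq_ltn_trans (leq_div _ _) xw. Qed.

Lemma eval_mod x y : x < 2 ^ w -> eval_op w OpMod x y = x %% y.
Proof. by move=> xw; apply: modn_small; apply: leq_ltn_trans (leq_mod _ _) xw. Qed.

Lemma eval_shr x y : x < 2 ^ w -> eval_op w OpShr x y = x %/ 2 ^ y.
Proof. by move=> xw; apply: modn_small; apply: leq_ltn_trans (leq_div _ _) xw. Qed.

Lemma eval_shl x y : eval_op w OpShl x y = (x * 2 ^ y) %% 2 ^ w.
Proof. by []. Qed.

End Eval.

(** Each child has b^(size gs) leaves below it: the quotient of [i] selects the child, the remainder
    the leaf below that child. *)
Lemma nth_expand (X H : finType) b (h : H -> X -> b.-tuple X) g gs x x0 i :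
  i < b ^ (size gs).+1 ->
  nth x0 (expand h (g :: gs) x) i =
  nth x0 (expand h gs (nth x0 (h g x) (i %/ b ^ size gs))) (i %% b ^ size gs).
Proof.
rewrite expnS -[X in _ < X * _](size_tuple (h g x)) /=.
elim: (val (h g x)) i => [|y s IH] i //=; set m := b ^ _ in IH *.
rewrite mulSn nth_cat size_expand -/m => i_lt; case: (ltnP i m) => [im|mi].
  by rewrite divn_small // modn_small.
have m0 : 0 < m by case: (m) i_lt mi => //; rewrite muln0.
rewrite IH; last by rewrite ltn_subLR.
rewrite -[in RHS](subnK mi) divnDr ?dvdnn // divnn m0 addn1 /=.
by rewrite modnDr.
Qed.

(** Follows from k <= b^(k-1). It keeps the number k b of hash functions below N, so that seed
    positions fit in a word. *)
Lemma mul_le_expn b k : 1 < b -> 0 < k -> k * b <= b ^ k.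
Proof.
move=> b1; case: k => // k _; rewrite expnSr leq_mul2r; apply/orP; right.
by apply: leq_trans (ltn_expl k b1) _.
Qed.

(** * Execution of the program *)

Section Run.
Variables n b k w v : nat.
Hypotheses (n_gt0 : 0 < n) (b_gt1 : 1 < b) (k_gt0 : 0 < k).
Hypotheses (bk_lt : b ^ k < 2 ^ n) (nw : 8 * n <= w).
Variable M : nat -> nat.
Hypothesis ME : forall a, M a = v %/ 2 ^ (a * w) %% 2 ^ w.
Local Notation N := (2 ^ n).

Let N_gt1 : 1 < N. Proof. by rewrite -[1](expn0 2) ltn_exp2l. Qed.

Let N8_le : N ^ 8 <= 2 ^ w.
Proof. by rewrite -expnM leq_exp2l // mulnC. Qed.

Let expN_lt m : m < 8 -> N ^ m < 2 ^ w.
Proof. by move=> m8; apply: leq_trans N8_le; rewrite ltn_exp2l. Qed.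

Let N_lt : N < 2 ^ w. Proof. exact: (@expN_lt 1). Qed.

Let N4E : N ^ 4 = N ^ 2 * N ^ 2. Proof. by rewrite -expnD. Qed.

Let n_lt : n < N. Proof. exact: ltn_expl. Qed.

Let w_lt : w < 2 ^ w. Proof. exact: ltn_expl. Qed.

(** Contents of R0 to R17: [l] is the counter, [x] the current label, [p] the number of leaves below
    it, and the last five are scratch. *)
Definition reg_file (i l x p j1 j2 j3 j4 j5 : nat) : seq nat :=
  [:: n; b; k; i; w; 1; N; N ^ 2; (N ^ 2) ^ 2; n * 4; l; x; p; j1; j2; j3; j4; j5].

Ltac op u := apply: (@reach_op _ _ _ u);
  [reflexivity | reflexivity | rewrite /= | rewrite /=].

(** The summand 1 covers the index of the following memory word. The bound is N * 4N <= N^4, from l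
    b + d + 1 <= k b <= b^k < N. *)
Lemma hash_position_lt l d : l < k -> d < b -> (l * b + d) * (n * 4) + n + 1 < 2 ^ w.
Proof.
move=> lk db; apply: (@leq_ltn_trans (N ^ 4)); last exact: expN_lt.
apply: (@leq_trans ((l * b + d).+1 * (n * 4))).
  by rewrite mulSn [X in _ <= X]addnC -addnA leq_add2l; lia.
have jN : (l * b + d).+1 <= N.
  apply: leq_trans (ltnW bk_lt); apply: leq_trans (mul_le_expn b_gt1 k_gt0).
  by rewrite (@leq_trans (l.+1 * b)) ?leq_mul2r ?lk ?orbT // mulSn addnC ltn_add2r.
apply: (@leq_trans (N * (N * 4))).
  by rewrite leq_mul // leq_mul2r ltnW ?orbT.
rewrite mulnA mulnn N4E leq_mul2l.
by rewrite -[4]/(2 ^ 2) leq_exp2r // N_gt1 orbT.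
Qed.

(** The left shift and the addition may overflow, harmlessly: 2^m divides 2^w. *)
Lemma load_seed_word o m : m <= w ->
  eval_op w OpMod
    (eval_op w OpAdd
       (eval_op w OpShr (M (o %/ w)) (o %% w))
       (eval_op w OpShl (M (o %/ w + 1)) (w - o %% w))) (2 ^ m) =
  v %/ 2 ^ o %% 2 ^ m.
Proof.
move=> mw; have W0 : 0 < 2 ^ w by rewrite expn_gt0.
have w0 : 0 < w by apply: leq_trans nw; rewrite muln_gt0.
rewrite eval_mod ?ltn_mod // eval_shr ?ME ?ltn_mod // eval_shl.
rewrite /eval_op modnDmr modn_dvdm ?dvdn_exp2l // read_bits // ltn_mod //.
Qed.

(** One pass through instructions 14 to 38. It starts by dividing R12 by b, hence [b * p] on
    entry. *)
Lemma run_level i l x p j1 j2 j3 j4 j5 :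
  l < k -> 0 < p -> b * p <= b ^ k -> i < b * p -> x < N ->
  exists j1' j2' j3' j4' j5',
  reach w prg_program M 14 (reg_file i l x (b * p) j1 j2 j3 j4 j5)
    25 (if l.+1 < k then 14 else 39)
    (reg_file (i %% p) l.+1 (mshash N (seed_word n v (l * b + i %/ p)) x) p
       j1' j2' j3' j4' j5').
Proof.
(* The scratch contents are determined by the execution that follows. *)
move=> lk p0 bp_le i_lt xN; do 5!eexists.
have b0 : 0 < b by apply: ltnW.
have db : i %/ p < b by rewrite ltn_divLR.
have ltw z : z < N -> z < 2 ^ w by move=> zN; apply: ltn_trans N_lt.
have bpN : b * p < N by apply: leq_ltn_trans bk_lt.
have iN : i < N by apply: ltn_trans bpN.
have N2w : N ^ 2 < 2 ^ w by apply: expN_lt.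
have := hash_position_lt lk db; set d := i %/ p; set o := _ + n => o_lt.
have oE : (l * b + d) * (n * 4) + n = o by [].
have o_lt' : o < 2 ^ w by apply: ltn_trans o_lt; rewrite addn1.
have pos_lt : (l * b + d) * (n * 4) < 2 ^ w.
  by apply: leq_ltn_trans o_lt'; rewrite leq_addr.
have idx_lt : l * b + d < 2 ^ w.
  by apply: leq_ltn_trans pos_lt; rewrite leq_pmulr // muln_gt0 n_gt0.
have n4w : n * 4 <= w by apply: leq_trans nw; rewrite mulnC leq_mul2r orbT.
have u_lt : seed_word n v (l * b + d) < 2 ^ w.
  by apply: (@leq_trans (2 ^ (n * 4))); rewrite ?ltn_mod ?expn_gt0 ?leq_exp2l.
have w0 : 0 < w by apply: leq_trans n4w; rewrite muln_gt0 n_gt0.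
op p; first by rewrite eval_div ?mulKn // ltw.
op d; first by rewrite eval_div // ltw.
op (i %% p); first by rewrite eval_mod // ltw.
op (l * b); first by rewrite eval_mul // (leq_ltn_trans _ idx_lt) ?leq_addr.
op (l * b + d); first exact: eval_add.
op ((l * b + d) * (n * 4)); first exact: eval_mul.
op o; first exact: eval_add.
op (o %/ w); first exact: eval_div.
op (o %% w); first exact: eval_mod.
apply: (@reach_load _ _ _ (M (o %/ w))) => //=.
op (eval_op w OpShr (M (o %/ w)) (o %% w)); first by [].
op (o %/ w + 1).
  by apply: eval_add; apply: leq_ltn_trans o_lt; rewrite leq_add2r leq_div.
apply: (@reach_load _ _ _ (M (o %/ w + 1))) => //=.
op (w - o %% w); first by rewrite eval_sub // ltnW // ltn_mod.
op (eval_op w OpShl (M (o %/ w + 1)) (w - o %% w)); first by [].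
op (eval_op w OpAdd (eval_op w OpShr (M (o %/ w)) (o %% w))
  (eval_op w OpShl (M (o %/ w + 1)) (w - o %% w))); first by [].
op (seed_word n v (l * b + d)).
  rewrite -!expnM load_seed_word // /seed_word -oE addnC.
  by rewrite [_ * (n * 4)]mulnC.
set u := seed_word _ _ _ in u_lt *.
have a_lt : u %% N ^ 2 < N ^ 2 by rewrite ltn_mod !expn_gt0.
have c_lt : u %/ N ^ 2 < N ^ 2.
  by rewrite ltn_divLR ?mulnn ?seed_word_lt // !expn_gt0.
have ac_lt : u %% N ^ 2 * x + u %/ N ^ 2 < 2 ^ w.
  apply: leq_ltn_trans (expN_lt (isT : 4 < 8)).
  apply: (@leq_trans (N ^ 2 * N + N ^ 2)).
    by rewrite leq_add ?leq_mul ?(ltnW a_lt) ?(ltnW c_lt) ?(ltnW xN).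
  rewrite -mulnSr N4E leq_mul2l -mulnn.
  by rewrite (@leq_trans (N * 2)) ?leq_mul2l ?N_gt1 ?orbT //; lia.
op (u %% N ^ 2); first exact: eval_mod.
op (u %/ N ^ 2); first exact: eval_div.
op (u %% N ^ 2 * x).
  by apply: eval_mul; apply: leq_ltn_trans ac_lt; rewrite leq_addr.
op (u %% N ^ 2 * x + u %/ N ^ 2); first exact: eval_add.
op ((u %% N ^ 2 * x + u %/ N ^ 2) %% N ^ 2); first exact: eval_mod.
op (mshash N u x).
  by apply: eval_div; apply: ltn_trans N2w; rewrite ltn_mod !expn_gt0.
op l.+1.
  rewrite eval_add ?addn1 //; apply: leq_ltn_trans lk _; apply: ltw.
  by apply: ltn_trans bk_lt; apply: ltn_expl.
apply: (@reach_jump_lt); [reflexivity | reflexivity | rewrite /=].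
exact: reach0.
Qed.

Lemma run_start i : i < b ^ k ->
  reach w prg_program M 0 ([:: n; b; k; i; w] ++ nseq 13 0)
    10 10 (reg_file i 0 (v %% N) 1 0 0 0 0 0).
Proof.
move=> ik; have N2_lt : N ^ 2 < 2 ^ w by apply: expN_lt.
have const_lt c : c < 8 -> c < 2 ^ w.
  move=> c8; apply: leq_trans (leq_trans nw (ltnW w_lt)).
  by apply: leq_trans c8 _; rewrite leq_pmulr.
have n4_lt : 4 * n < 2 ^ w.
  by apply: leq_ltn_trans w_lt; apply: leq_trans nw; rewrite leq_mul2r orbT.
apply: (@reach_const _ _ _ 1); [reflexivity | by [] | exact: const_lt | rewrite /=].
op (2 ^ n); first by rewrite eval_shl mul1n modn_small.
op (N ^ 2); first by rewrite eval_mul mulnn.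
op ((N ^ 2) ^ 2); first by rewrite eval_mul mulnn // -expnM; apply: expN_lt.
apply: (@reach_const _ _ _ 4); [reflexivity | by [] | exact: const_lt | rewrite /=].
op (n * 4); first by rewrite eval_mul mulnC // mulnC.
apply: (@reach_const _ _ _ 0); [reflexivity | by [] | exact: const_lt | rewrite /=].
apply: (@reach_load _ _ _ (M 0)) => //=.
op (v %% N).
  rewrite ME mul0n divn1 eval_mod ?ltn_mod ?expn_gt0 // modn_dvdm //.
  by rewrite dvdn_exp2l // (leq_trans _ nw) // leq_pmull.
apply: (@reach_const _ _ _ 1); [reflexivity | by [] | exact: const_lt | rewrite /=].
exact: reach0.
Qed.

(** The loop tests after its body; the induction is on the m + 1 remaining passes, of three
    instructions each. *)
Lemma run_power i l x m : l + m.+1 = k ->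
  reach w prg_program M 10 (reg_file i l x (b ^ l) 0 0 0 0 0)
    (3 * m.+1) 13 (reg_file i k x (b ^ k) 0 0 0 0 0).
Proof.
elim: m l => [|m IH] l lk; rewrite mulnS addnC;
  (apply: (reach_trans (l2 := if l.+1 < k then 10 else 13)
     (vs2 := reg_file i l.+1 x (b ^ l.+1) 0 0 0 0 0)); last first).
- by rewrite -lk addn1 ltnn; apply: reach0.
- have bl : b ^ l.+1 < 2 ^ w.
    apply: ltn_trans N_lt; apply: leq_ltn_trans bk_lt.
    by rewrite leq_exp2l // -lk addn1.
  op (b ^ l.+1); first by rewrite eval_mul -expnSr.
  op l.+1.
    by rewrite eval_add ?addn1 // (ltn_trans _ bl) // ltn_expl.
  by apply: reach_jump_lt; [reflexivity | reflexivity | apply: reach0].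
- have -> : l.+1 < k by lia.
  by apply: IH; rewrite addSnnS.
- have bl : b ^ l.+1 < 2 ^ w.
    apply: ltn_trans N_lt; apply: leq_ltn_trans bk_lt.
    by rewrite leq_exp2l // -lk addnS ltnS leq_addr.
  op (b ^ l.+1); first by rewrite eval_mul -expnSr.
  op l.+1.
    by rewrite eval_add ?addn1 // (ltn_trans _ bl) // ltn_expl.
  by apply: reach_jump_lt; [reflexivity | reflexivity | apply: reach0].
Qed.

(** Counterpart of [run_level] on the tree: the label that the machine computes is that of the child
    above leaf [i]. *)
Lemma nth_leaves (r : (seed_size n b k).-tuple bool) x0 m l i (x : 'I_N) :
  l + m.+1 = k -> i < b ^ m.+1 ->
  exists2 y : 'I_N,
    mshash N (seed_word n (bits_val r) (l * b + i %/ b ^ m)) x = y &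
    nth x0 (expand (@hash_level n b) (drop l (seed_hashes r)) x) i =
    nth x0 (expand (@hash_level n b) (drop l.+1 (seed_hashes r)) y) (i %% b ^ m).
Proof.
move=> lk i_lt; have lk' : l < k by rewrite -lk addnS ltnS leq_addr.
have db : i %/ b ^ m < b by rewrite ltn_divLR ?expn_gt0 ?(ltnW b_gt1) // -expnS.
pose g := tnth (seed_hashes r) (Ordinal lk').
exists (tnth (hash_level g x) (Ordinal db)).
  by rewrite tnth_mktuple /g !tnth_mktuple.
rewrite (drop_nth g) ?size_tuple // -[nth _ _ l](tnth_nth g _ (Ordinal lk')) -/g.
have sz : size (drop l.+1 (seed_hashes r)) = m.
  by rewrite size_drop size_tuple -lk -addSnnS addKn.
by rewrite nth_expand sz // (tnth_nth x0).
Qed.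

(** Loop invariant: the wanted leaf is the [i]-th one below the current node. *)
Lemma run_levels (r : (seed_size n b k).-tuple bool) x0 m l i (x : 'I_N) j1 j2 j3 j4 j5 :
  v = bits_val r -> l + m.+1 = k -> i < b ^ m.+1 ->
  exists i' j1' j2' j3' j4' j5',
  reach w prg_program M 14 (reg_file i l x (b ^ m.+1) j1 j2 j3 j4 j5)
    (25 * m.+1) 39
    (reg_file i' k (nth x0 (expand (@hash_level n b) (drop l (seed_hashes r)) x) i) 1
       j1' j2' j3' j4' j5').
Proof.
move=> vE; have b0 : 0 < b by apply: ltnW.
elim: m l i x j1 j2 j3 j4 j5 => [|m IH] l i x j1 j2 j3 j4 j5 lk i_lt;
  have [y yE ->] := nth_leaves r x0 x lk i_lt;
  have lk' : l < k by [rewrite -lk addnS ltnS leq_addr];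
  rewrite expnS in i_lt *.
- have [||j1' [j2' [j3' [j4' [j5' H]]]]] :=
    run_level j1 j2 j3 j4 j5 lk' _ _ i_lt (ltn_ord x).
  + by rewrite expn0.
  + by rewrite muln1 -{1}[b]expn1 leq_exp2l.
  have l1k : l.+1 = k by rewrite -lk addn1.
  rewrite vE yE l1k ltnn in H.
  exists (i %% b ^ 0), j1', j2', j3', j4', j5'.
  by rewrite drop_oversize ?size_tuple ?l1k //= expn0 modn1 muln1 in H *.
- have [||j1' [j2' [j3' [j4' [j5' H]]]]] :=
    run_level j1 j2 j3 j4 j5 lk' _ _ i_lt (ltn_ord x).
  + by rewrite expn_gt0 b0.
  + by rewrite -expnS leq_exp2l // -lk leq_addl.
  have lk2 : l.+1 + m.+1 = k by rewrite addSnnS.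
  rewrite vE yE -[in if _ then _ else _]lk2 addnS ltnS leq_addr in H.
  have [|i' [j1'' [j2'' [j3'' [j4'' [j5'' H']]]]]] :=
    IH l.+1 (i %% b ^ m.+1) y j1' j2' j3' j4' j5' lk2.
    by rewrite ltn_mod expn_gt0 b0.
  exists i', j1'', j2'', j3'', j4'', j5''.
  by rewrite mulnS addnC; apply: reach_trans H H'.
Qed.

(** Steps, from the last phase to the first: 2 to copy the label to R0, 25 k for the descent, 1 to
    reset the counter, 3 k for the power, 10 for the set-up. *)
Lemma run_program (r : (seed_size n b k).-tuple bool) i :
  v = bits_val r -> i < b ^ k ->
  exists2 vs, 0 < size vs /\ nth 0 vs 0 = nth (seed_root r) (prg_leaves r) i &
    reach w prg_program M 0 ([:: n; b; k; i; w] ++ nseq 13 0)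
      (2 + (25 * k + (1 + (3 * k + 10)))) 41 vs.
Proof.
move=> vE ik; set y := nth _ _ i.
have [m mk] : exists m, 0 + m.+1 = k by exists k.-1; rewrite prednK.
have ik' : i < b ^ m.+1 by rewrite [m.+1]mk.
have r2 := run_power (i := i) (x := v %% N) mk.
have [i' [j1 [j2 [j3 [j4 [j5 r4]]]]]] :=
  run_levels (seed_root r) (seed_root r) 0 0 0 0 0 vE mk ik'.
have rootE : seed_root r = v %% N :> nat by rewrite vE.
rewrite [m.+1]mk in r2 r4; rewrite drop0 -/(prg_leaves r) -/y rootE in r4.
have r3 : reach w prg_program M 13 (reg_file i k (v %% N) (b ^ k) 0 0 0 0 0)
    1 14 (reg_file i 0 (v %% N) (b ^ k) 0 0 0 0 0).
  by apply: (@reach_const _ _ _ 0);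
     [reflexivity | by [] | rewrite expn_gt0 | apply: reach0].
exists (set_nth 0 (reg_file i' k y 1 j1 j2 j3 j4 j5) 0 y) => //.
apply: reach_trans (reach_trans (reach_trans (reach_trans (run_start ik) r2) r3) r4) _.
apply: (@reach_const _ _ _ 0); [reflexivity | by [] | by rewrite expn_gt0 | rewrite /=].
op (nat_of_ord y); first by rewrite eval_add // (ltn_trans (ltn_ord y)).
exact: reach0.
Qed.

End Run.

Lemma prg_program_correct n b k w (r : (seed_size n b k).-tuple bool) (i : 'I_(b ^ k)) :
  0 < n -> 1 < b -> 0 < k -> b ^ k < 2 ^ n -> 8 * n <= w ->
  ram_computes w prg_program [:: n; b; k; nat_of_ord i; w] r (41 * k)
    (bits_val (block (fast_prg r) i)).
Proof.
move=> n0 b1 k0 bkN nw.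
have ME a : bits_val (take w (drop (a * w) r)) = bits_val r %/ 2 ^ (a * w) %% 2 ^ w.
  by rewrite bits_val_take bits_val_drop.
have [vs [vs0 vsE] H] := run_program n0 b1 k0 bkN nw ME (erefl _) (ltn_ord i).
have Nw : 2 ^ n < 2 ^ w.
  by rewrite ltn_exp2l // (leq_trans _ nw) // ltn_Pmull.
have b_lt : b < 2 ^ n by apply: leq_ltn_trans bkN; rewrite -{1}[b]expn1 leq_exp2l.
have k_lt : k < 2 ^ n by apply: ltn_trans bkN; apply: ltn_expl.
have R0 : regs ([:: n; b; k; nat_of_ord i; w] ++ nseq 13 0)
    (fun j => nth 0 [:: n; b; k; nat_of_ord i; w] j %% 2 ^ w).
  move=> j _; rewrite nth_cat; case: ltnP => j5; last first.
    by rewrite nth_nseq if_same nth_default ?mod0n.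
  apply: modn_small.
  have /(all_nthP 0) : all (gtn (2 ^ w)) [:: n; b; k; nat_of_ord i; w].
    have i_lt : i < 2 ^ n := ltn_trans (ltn_ord i) bkN.
    have n_lt : n < 2 ^ n by apply: ltn_expl.
    by apply/and5P; split; rewrite /= ?andbT ?(ltn_expl w) //; apply: ltn_trans Nw.
  by apply.
have [R RE E] := H _ R0.
exists (2 + (25 * k + (1 + (3 * k + 10)))).
rewrite block_fast_prg bits_val_to_bits ?ltn_ord // [ram_init _ _ _]/ram_init E.
(* 28 k + 13 <= 41 k because k >= 1. *)
by split=> //; [lia | rewrite /= RE].
Qed.

(** * Acceptance probabilities and choice of the constants *)

Local Open Scope ring_scope.

Lemma accept_prob_matrix (R : realType) m n (Q : fsm n)
    (D : m.-tuple (n.-tuple bool) -> R)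
    (q0 : 'I_(nstates Q)) (A : {set 'I_(nstates Q)}) :
  accept_prob D q0 A = \sum_(j in A) fsm_matrix Q D q0 j.
Proof.
rewrite /accept_prob (partition_big
  (fun x : m.-tuple (n.-tuple bool) => final_state Q q0 x) (mem A)) //=.
apply: eq_bigr => j jA; rewrite mxE; apply: eq_bigl => x.
by case: (final_state Q q0 x =P j) => [->|]; rewrite ?jA ?andbF.
Qed.

(** The difference is a partial sum of row [q0] of the difference matrix. *)
Lemma accept_prob_dist (R : realType) m n (Q : fsm n)
    (D D' : m.-tuple (n.-tuple bool) -> R)
    (q0 : 'I_(nstates Q)) (A : {set 'I_(nstates Q)}) :
  `|accept_prob D q0 A - accept_prob D' q0 A|
    <= row_sum_norm (fsm_matrix Q D - fsm_matrix Q D').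
Proof.
rewrite !accept_prob_matrix -sumrB.
move: (fsm_matrix Q D) (fsm_matrix Q D') => M M'; apply: le_trans (row_sum_le_norm _ q0).
apply: le_trans (ler_norm_sum _ _ _) _; rewrite big_mkcond.
by apply: ler_sum => j _; rewrite !mxE; case: (j \in A); rewrite ?normr0.
Qed.

Theorem theorem3p2 (R : realType) :
  exists (c : R) (Cseed Ctime Cword : nat) (Cerr : R) (P : program),
    0 < c /\
    forall n b k : nat, (0 < n)%N -> (2 <= b)%N -> (0 < k)%N ->
    (b ^ k)%:R <= 2 `^ (c * n%:R) ->
    exists (s : nat) (FastPRG : s.-tuple bool -> (b ^ k * n).-tuple bool),
    [/\ (s <= Cseed * (b * k * n))%N,
        forall Q : fsm n, (nstates Q)%:R <= 2 `^ (c * n%:R) ->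
          row_sum_norm (fsm_matrix Q (prg_dist R FastPRG) -
                        fsm_matrix Q (uniform_string R (b ^ k) n))
            <= Cerr * 2 `^ (- (c * n%:R))
          /\
          forall (q0 : 'I_(nstates Q)) (A : {set 'I_(nstates Q)}),
            `|accept_prob (prg_dist R FastPRG) q0 A -
              accept_prob (uniform_string R (b ^ k) n) q0 A|
              <= Cerr * 2 `^ (- (c * n%:R))
      & forall (w : nat) (r : s.-tuple bool) (i : 'I_(b ^ k)),
          (Cword * n <= w)%N ->
          ram_computes w P [:: n; b; k; nat_of_ord i; w] r
            (Ctime * k) (bits_val (block (FastPRG r) i))].
Proof.
(* With c = 1/8, q = 2^(cn) satisfies q^8 = 2^n. The seed has n + 4nkb <= 5bkn bits, and words of 8n
   bits hold all intermediate values such as N^4. *)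
exists 8%:R^-1, 5, 41, 8, 1, prg_program; split; first by rewrite invr_gt0.
move=> n b k n0 b2 k0; set q := 2 `^ _ => bkq.
have q8 : q ^+ 8 = (2 ^ n)%:R.
  rewrite natrX -[RHS]powR_mulrn // -[LHS]powR_mulrn ?powR_ge0 //.
  by rewrite -powRrM mulrAC mulVf ?mul1r // pnatr_eq0.
(* From 2 <= b^k <= q; this makes b^k < 2^n strict. *)
have q1 : 1 < q.
  apply: lt_le_trans bkq; rewrite ltr1n (@leq_trans (b ^ 1)) //.
  by rewrite leq_exp2l.
have q0 : 0 < q by apply: lt_trans q1.
have bkN : (b ^ k < 2 ^ n)%N.
  rewrite -(ltr_nat R) -q8; apply: le_lt_trans bkq _.
  by rewrite -{1}[q]expr1 ltr_eXn2l.
have sqrtN : Num.sqrt (2 ^ n)%:R = q ^+ 4.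
  by rewrite -q8 (exprM q 4 2) sqrtr_sqr ger0_norm // exprn_ge0 // ltW.
have err (Q : fsm n) : (nstates Q)%:R <= q ->
    row_sum_norm (fsm_matrix Q (prg_dist R (@fast_prg n b k)) -
                  fsm_matrix Q (uniform_string R (b ^ k) n))
      <= 1 * 2 `^ (- (8%:R^-1 * n%:R)).
  move=> Sq; apply: le_trans (prg_error _ _ _ b2) _.
  rewrite mul1r powRN -/q sqrtN.
  (* The bound S^2 N^(-1/2) b^k is at most q^2 q^(-4) q. *)
  have -> : q^-1 = q ^+ 2 * (q ^+ 4)^-1 * q by field; rewrite gt_eqF.
  have qi : 0 <= (q ^+ 4)^-1 by rewrite invr_ge0 exprn_ge0 // ltW.
  rewrite ler_pM ?mulr_ge0 ?exprn_ge0 // ler_wpM2r // lerXn2r ?nnegrE //.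
  exact: ltW.
exists (seed_size n b k), (@fast_prg n b k); split.
- have : (n <= b * k * n)%N by rewrite leq_pmull // muln_gt0 k0 ltnW.
  rewrite /seed_size; lia.
- move=> Q Sq; split=> [|i A]; first exact: err.
  exact: le_trans (accept_prob_dist _ _ _ _) (err Q Sq).
- by move=> w r i nw; apply: prg_program_correct.
Qed.
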